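(* Let $(F_n)_{n\ge1}$ be the Fibonacci numbers $F_1=1$, $F_2=2$, $F_n=F_{n-1}+F_{n-2}$ for $n\ge 3$. For each of the following sets $P$ of generalized patterns, $|S_n(P)|=F_n$ for every $n\ge1$: $\{1\text{-}23,2\text{-}13,1\text{-}32,21\text{-}3\}$, $\{1\text{-}23,2\text{-}13,1\text{-}32,12\text{-}3\}$, $\{1\text{-}23,2\text{-}13,13\text{-}2,21\text{-}3\}$, $\{1\text{-}23,2\text{-}13,13\text{-}2,1\text{-}32\}$, $\{1\text{-}23,2\text{-}13,13\text{-}2,12\text{-}3\}$, $\{1\text{-}23,21\text{-}3,13\text{-}2,1\text{-}32\}$, $\{1\text{-}23,13\text{-}2,3\text{-}12,1\text{-}32\}$, $\{1\text{-}23,1\text{-}32,31\text{-}2,3\text{-}12\}$, $\{1\text{-}23,13\text{-}2,31\text{-}2,1\text{-}32\}$, $\{1\text{-}23,13\text{-}2,31\text{-}2,3\text{-}12\}$.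
   Context: $S_n$ is the set of permutations $\pi=\pi_1\pi_2\cdots\pi_n$ of $\{1,\dots,n\}$. For $abc$ a permutation of $123$, the generalized pattern $a\text{-}bc$ is contained in $\pi$ if there are indices $i<j$ with $j+1\le n$ such that $\pi_i\pi_j\pi_{j+1}$ is order-isomorphic to $abc$; the generalized pattern $ab\text{-}c$ is contained in $\pi$ if there are indices $i,k$ with $i+1<k\le n$ such that $\pi_i\pi_{i+1}\pi_k$ is order-isomorphic to $abc$. (Letters not separated by a dash must occur in adjacent positions; letters separated by a dash need not be adjacent.) $\pi$ avoids a pattern if it does not contain it. For a set $P$ of generalized patterns, $S_n(P)$ is the set of $\pi\in S_n$ avoiding every pattern in $P$. *)

(* Defs.v *)
From HB Require Import structures.
From mathcomp Require Import all_boot all_fingroup.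
Set Implicit Arguments. Unset Strict Implicit. Unset Printing Implicit Defensive.

(* [a_bc a b c] is the generalized pattern a-bc and [ab_c a b c] is ab-c;
   the letters are meant to be a permutation of 1, 2, 3. *)
Inductive gpattern := a_bc of nat & nat & nat | ab_c of nat & nat & nat.

Definition gpattern_code (p : gpattern) : bool * (nat * nat * nat) :=
  match p with a_bc a b c => (true, (a, b, c)) | ab_c a b c => (false, (a, b, c)) end.

Definition gpattern_decode (x : bool * (nat * nat * nat)) : gpattern :=
  let: (d, (a, b, c)) := x in if d then a_bc a b c else ab_c a b c.

Lemma gpattern_codeK : cancel gpattern_code gpattern_decode.
Proof. by case. Qed.

HB.instance Definition _ := Equality.copy gpattern (can_type gpattern_codeK).

Definition order_iso3 (x y z a b c : nat) : bool :=
  [&& (x < y) == (a < b), (y < z) == (b < c), (x < z) == (a < c),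
      (y < x) == (b < a), (z < y) == (c < b) & (z < x) == (c < a)].

(* Positions and values of a permutation range over 0, ..., n-1 instead of
   1, ..., n; this affects neither adjacency nor relative order. *)
Definition contains (n : nat) (s : 'S_n) (p : gpattern) : bool :=
  match p with
  | a_bc a b c =>
      [exists i : 'I_n, exists j : 'I_n, exists k : 'I_n,
        [&& i < j, k == j.+1 :> nat & order_iso3 (s i) (s j) (s k) a b c]]
  | ab_c a b c =>
      [exists i : 'I_n, exists j : 'I_n, exists k : 'I_n,
        [&& j == i.+1 :> nat, j < k & order_iso3 (s i) (s j) (s k) a b c]]
  end.

Definition avoids (n : nat) (s : 'S_n) (p : gpattern) : bool := ~~ contains s p.

Definition avoiders (n : nat) (P : seq gpattern) : {set 'S_n} :=
  [set s : 'S_n | all (avoids s) P].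

(* Indexed so that F_1 = 1 and F_2 = 2; the value F_0 = 1 is the one forced by
   running the recurrence backwards. *)
Fixpoint F (n : nat) : nat :=
  match n with
  | 0 => 1
  | m.+1 => match m with 0 => 1 | k.+1 => F m + F k end
  end.

(* Main.v *)
Require Import Defs.
From mathcomp Require Import all_boot all_fingroup zify.

(** In each of the ten classes the minimum is the last or the penultimate
    letter: if three consecutive letters started with the minimum, they would
    form an occurrence of 1-23, or of both 1-32 and 13-2.  If the minimum is
    penultimate, the last letter is forced to be the second smallest one (first
    six classes) or the largest one (last four).  No pattern of the lists can
    use the deleted letters, so removing the minimum, respectively the last two
    letters, gives |S_n(P)| = |S_{n-1}(P)| + |S_{n-2}(P)|. *)

Set Implicit Arguments. Unset Strict Implicit. Unset Printing Implicit Defensive.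

(** * Occurrences as a condition on positions and one on relative order *)

Definition positions (p : gpattern) (i j k : nat) : bool :=
  match p with
  | a_bc _ _ _ => (i < j) && (k == j.+1)
  | ab_c _ _ _ => (j == i.+1) && (j < k)
  end.

Definition similar (p : gpattern) (x y z : nat) : bool :=
  match p with a_bc a b c | ab_c a b c => order_iso3 x y z a b c end.

Lemma order_iso3E x y z :
  (order_iso3 x y z 1 2 3 = (x < y < z)) * (order_iso3 x y z 1 3 2 = (x < z < y)) *
  (order_iso3 x y z 2 1 3 = (y < x < z)) * (order_iso3 x y z 3 1 2 = (y < z < x)).
Proof.
by rewrite /order_iso3; do ![split];
  case: (ltngtP x y) => // ?; case: (ltngtP y z) => // ?; case: (ltngtP x z) => // ?; lia.
Qed.

Lemma containsP n (s : 'S_n) (p : gpattern) :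
  reflect (exists i j k : 'I_n, positions p i j k /\ similar p (s i) (s j) (s k))
          (contains s p).
Proof.
apply: (iffP idP); case: p => a b c.
1,2: move=> /existsP[i /existsP[j /existsP[k /and3P[? ? ?]]]].
1,2: by exists i, j, k; split => //; apply/andP.
all: move=> [i [j [k [/andP[? ?] ?]]]]; apply/existsP; exists i.
all: by apply/existsP; exists j; apply/existsP; exists k; apply/and3P.
Qed.

Lemma positions_lt p i j k : positions p i j k -> i < j < k.
Proof. by case: p => a b c /=; lia. Qed.

(** * Appending and deleting the last letter *)

Lemma ltn_bump2 h x y : (bump h x < bump h y) = (x < y).
Proof. by rewrite /bump; lia. Qed.

Lemma similar_bump h p x y z :
  similar p (bump h x) (bump h y) (bump h z) = similar p x y z.
Proof. by case: p => a b c; rewrite /= /order_iso3 !ltn_bump2. Qed.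

(** [lift_perm ord_max x s] appends the letter [x] and raises the letters of [s] that are at least
    [x], which keeps their relative order. As positions increase, the new letter can only be the
    third of an occurrence. *)
Lemma contains_lift_perm_max n (x : 'I_n.+1) (s : 'S_n) p :
  (forall i j : 'I_n, positions p i j n ->
     ~~ similar p (bump x (s i)) (bump x (s j)) x) ->
  contains (lift_perm ord_max x s) p = contains s p.
Proof.
move=> notlast; apply/containsP/containsP => [[i [j [k]]] | [i [j [k []]]]].
  case: (unliftP ord_max i) => [i' -> | ->]; last first.
    by case=> /positions_lt /=; have := ltn_ord j; have := ltn_ord k; lia.
  case: (unliftP ord_max j) => [j' -> | ->]; last first.
    by case=> /positions_lt /=; have := ltn_ord k; lia.
  case: (unliftP ord_max k) => [k' -> | ->]; rewrite !lift_max.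
    rewrite !lift_perm_lift /= similar_bump => -[pos sim].
    by exists i', j', k'.
  rewrite !lift_perm_lift lift_perm_id /= => -[pos sim].
  by have := notlast _ _ pos; rewrite sim.
move=> pos sim; exists (lift ord_max i), (lift ord_max j), (lift ord_max k).
by rewrite !lift_perm_lift !lift_max /= similar_bump.
Qed.

Lemma lift_perm_surj n (i : 'I_n.+1) (s : 'S_n.+1) : exists t : 'S_n, s = lift_perm i (s i) t.
Proof.
have ne k : s i != s (lift i k) by rewrite (inj_eq perm_inj) neq_lift.
(* The default [k] is never taken: by [ne], [unlift] always succeeds. *)
pose f k := odflt k (unlift (s i) (s (lift i k))).
have fE k : lift (s i) (f k) = s (lift i k).
  by rewrite /f; case: (unlift_some (ne k)) => j -> ->.
have f_inj : injective f.
  by move=> k l e; apply/(@lift_inj _ i)/(@perm_inj _ s); rewrite -!fE e.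
exists (perm f_inj); apply/permP => k.
case: (unliftP i k) => [k' -> | ->]; last by rewrite lift_perm_id.
by rewrite lift_perm_lift permE fE.
Qed.

Lemma lift_perm_inj n (i j : 'I_n.+1) : injective (@lift_perm n i j).
Proof.
move=> s t e; apply/permP => k; apply: (@lift_inj _ j).
by rewrite -!(lift_perm_lift i) e.
Qed.

Lemma card_avoiders_rec n (P : seq gpattern) (x : 'I_n.+2) :
  0 < x ->
  (forall m (s : 'S_m), {in P, forall p,
     contains (lift_perm ord_max ord0 s) p = contains s p}) ->
  (forall s : 'S_n, {in P, forall p,
     contains (lift_perm ord_max x (lift_perm ord_max ord0 s)) p = contains s p}) ->
  {in avoiders n.+2 P, forall s : 'S_n.+2, s ord_max != ord0 ->
     s (lift ord_max ord_max) = ord0 /\ s ord_max = x} ->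
  #|avoiders n.+2 P| = #|avoiders n.+1 P| + #|avoiders n P|.
Proof.
move=> x_gt0 lift0 lift2 last.
pose g1 := @lift_perm n.+1 ord_max ord0.
pose g2 := @lift_perm n.+1 ord_max x \o @lift_perm n ord_max ord0.
have g2_inj : injective g2 by apply: inj_comp; exact: lift_perm_inj.
rewrite -(card_imset (avoiders n.+1 P) (@lift_perm_inj n.+1 ord_max ord0)) -/g1.
rewrite -(card_imset (avoiders n P) g2_inj) -cardsUI.
(* A common word would have both 0 and [x] as its last letter. *)
have -> : [set g1 s | s in avoiders n.+1 P] :&: [set g2 s | s in avoiders n P] = set0.
  apply/setP => s; rewrite !inE; apply/negP => /andP[/imsetP[t _ ->] /imsetP[u _]].
  move=> /permP/(_ ord_max); rewrite !lift_perm_id => e.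
  by rewrite -e in x_gt0.
rewrite cards0 addn0; apply: eq_card => s; apply/idP/setUP.
  move=> sP; have [s0 | s0] := eqVneq (s ord_max) ord0.
    left; have [t e] := lift_perm_surj ord_max s; rewrite s0 in e.
    apply/imsetP; exists t => //; move: sP; rewrite !inE e.
    by congr is_true; apply: eq_in_all => p pP; rewrite /avoids lift0.
  right; have [s1 sx] := last s sP s0.
  have [t e] := lift_perm_surj ord_max s; rewrite sx in e.
  have [u e'] := lift_perm_surj ord_max t.
  (* As [x] is positive, [lift x] fixes the letter 0, so the penultimate 0 of [s] is still 0 in
     [t]. *)
  have t0 : t ord_max = ord0.
    apply: (@lift_inj _ x); rewrite -(lift_perm_lift ord_max) -e s1.
    by apply/val_inj; rewrite /= /bump; lia.
  rewrite t0 in e'; apply/imsetP; exists u; last by rewrite e e'.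
  move: sP; rewrite !inE e e'.
  by congr is_true; apply: eq_in_all => p pP; rewrite /avoids lift2.
case=> /imsetP[t tP ->]; move: tP; rewrite !inE; congr is_true.
  by apply: eq_in_all => p pP; rewrite /avoids lift0.
by apply: eq_in_all => p pP; rewrite /avoids lift2.
Qed.

(** A final minimum can only be a smallest third letter, and the two letters before it compare as in
    1 2 0 or in 2 1 0; testing these two triples suffices. *)
Lemma contains_lift0 n (s : 'S_n) p :
  ~~ similar p 1 2 0 -> ~~ similar p 2 1 0 ->
  contains (lift_perm ord_max ord0 s) p = contains s p.
Proof.
move=> h1 h2; apply: contains_lift_perm_max => i j /positions_lt/andP[ij _].
have: s i != s j by rewrite (inj_eq perm_inj) -(inj_eq val_inj) /= neq_ltn ij.
rewrite -(inj_eq val_inj) /= /bump !leq0n.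
case: p h1 h2 => a b c; rewrite /= /order_iso3 !ltn_add2l !ltn0 /=;
  by case: (ltngtP (s i) (s j)).
Qed.

(** Apart from 1-23, no listed pattern ends in its largest letter, so the final maximum cannot
    complete it. *)
Lemma contains_lift_top n (s : 'S_n) p :
  p \in [:: a_bc 1 2 3; a_bc 1 3 2; a_bc 3 1 2; ab_c 1 3 2; ab_c 3 1 2] ->
  contains (lift_perm ord_max ord_max (lift_perm ord_max ord0 s)) p = contains s p.
Proof.
move=> pP; rewrite contains_lift_perm_max => [|i j].
  by apply: contains_lift0; move: pP; rewrite !inE => /or4P[||| /orP[]] /eqP->.
set t := lift_perm _ _ _; move=> pos; move: pP.
have bj k : bump n.+1 (t k) = t k by rewrite /bump; have := ltn_ord (t k); lia.
rewrite /= !bj; have := ltn_ord (t i); have := ltn_ord (t j) => lj li.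
rewrite !inE => /or4P[|||/orP[]] /eqP e; move: pos; rewrite e /= !order_iso3E; try lia.
(* Left is the pattern 1-23: an occurrence would need a value below the one at [j], which is 0. *)
move=> /andP[_ /eqP[jn]]; have -> : j = ord_max by exact: val_inj.
by rewrite /t lift_perm_id /=; lia.
Qed.

(** Every listed pattern has its first letter below its third. An occurrence ending at the new
    letter 1 would start before the 0, hence with a letter at least 2. *)
Lemma contains_lift_second n (s : 'S_n) p :
  p \in [:: a_bc 1 2 3; a_bc 2 1 3; a_bc 1 3 2; ab_c 1 2 3; ab_c 2 1 3; ab_c 1 3 2] ->
  contains (lift_perm ord_max (inord 1) (lift_perm ord_max ord0 s)) p = contains s p.
Proof.
move=> pP; rewrite contains_lift_perm_max => [|i j].
  by apply: contains_lift0; move: pP; rewrite !inE => /or4P[||| /or3P[]] /eqP->.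
rewrite inordK //; set t := lift_perm _ _ _; move=> pos.
have lt1 : i < n.
  by have := positions_lt pos; have := ltn_ord j; lia.
have ti : 0 < t i.
  case: (unliftP ord_max i) lt1 => [i' -> _ | -> /=]; last by rewrite ltnn.
  by rewrite lift_perm_lift.
rewrite /bump ti; move: (t i) (t j) ti => u v _.
move: pP; rewrite !inE => /or4P[||| /or3P[]] /eqP->; rewrite /= !order_iso3E; lia.
Qed.

Section Word.
Variables (n : nat) (P : seq gpattern) (s : 'S_n.+2).
Hypotheses (sP : s \in avoiders n.+2 P).
(** Natural-number positions allow [i.+1] and [i + d]. An index beyond [n.+1] is sent by [inord] to
    position 0, hence the bounds in [word_avoids] and [word_inj]. *)
Let f (i : nat) : nat := s (inord i).

Lemma word_avoids p i j k : p \in P -> k < n.+2 -> positions p i j k ->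
  ~~ similar p (f i) (f j) (f k).
Proof.
move=> pP kn pos; have := positions_lt pos => /andP[ij jk].
move: sP; rewrite inE => /allP/(_ p pP); apply: contra => sim.
apply/containsP; have [hi hj] : i < n.+2 /\ j < n.+2 by lia.
by exists (inord i), (inord j), (inord k); rewrite !inordK.
Qed.

Lemma word_inj i j : i < n.+2 -> j < n.+2 -> f i = f j -> i = j.
Proof.
by move=> hi hj /val_inj/perm_inj/(congr1 val) /=; rewrite !inordK.
Qed.

Lemma word_surj v : v < n.+2 -> exists2 i, i < n.+2 & f i = v.
Proof.
move=> vn; exists (s^-1%g (inord v)) => //.
by rewrite /f inord_val permKV inordK.
Qed.

Lemma word_lt i : f i < n.+2.
Proof. exact: ltn_ord. Qed.

Hypothesis (last_neq0 : f n.+1 != 0).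

Lemma penultimate_eq0 :
  a_bc 1 2 3 \in P -> (a_bc 1 3 2 \in P) || (ab_c 1 3 2 \in P) -> f n = 0.
Proof.
move=> h123 h132; have [m mn fm] := word_surj (isT : 0 < n.+2).
have [-> //|ne] := eqVneq n m.
have lt_m : m.+2 < n.+2.
  by have : m != n.+1; [apply: contraNneq last_neq0 => <-; rewrite fm | lia].
have := @word_avoids _ m m.+1 m.+2 h123 lt_m.
have := @word_inj m m.+1; have := @word_inj m m.+2; have := @word_inj m.+1 m.+2.
(* Both dash placements of 132 fit the same three consecutive positions. *)
case/orP: h132 => h; have := @word_avoids _ m m.+1 m.+2 h lt_m;
  rewrite /= !order_iso3E fm; lia.
Qed.

Hypothesis (pen0 : f n = 0).

Lemma lt_penultimate i : i < n.+2 -> f i != 0 -> i != n.+1 -> i < n.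
Proof.
move=> hi fi ne; have : i != n by apply: contraNneq fi => ->; rewrite pen0.
lia.
Qed.

(** An earlier 1 would form 2-13 with the final two letters, a 0 and a letter above 1. *)
Lemma last_eq1_of_213 : a_bc 2 1 3 \in P -> f n.+1 = 1.
Proof.
move=> h; have [i hi fi] := word_surj (isT : 1 < n.+2).
have [<- //|ne] := eqVneq i n.+1.
have lt_i : i < n by apply: lt_penultimate => //; rewrite fi.
have := @word_inj i n.+1 hi.
have := @word_avoids _ i n n.+1 h; rewrite /= !order_iso3E fi pen0; lia.
Qed.

(** The cases follow the distance from the letter 1 to the penultimate 0; at distance 1, the word
    ends in 1, 0 and a larger letter, an occurrence of 21-3. *)
Lemma last_eq1_of_21_3 : a_bc 1 2 3 \in P -> a_bc 1 3 2 \in P ->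
  ab_c 1 3 2 \in P -> ab_c 2 1 3 \in P -> f n.+1 = 1.
Proof.
move=> h1 h2 h3 h4; have [i hi fi] := word_surj (isT : 1 < n.+2).
have [<- //|ne] := eqVneq i n.+1.
have lt_i : i < n by apply: lt_penultimate => //; rewrite fi.
have := @word_inj i n.+1 hi.
have [e|ne1] := eqVneq i.+1 n.
  have := @word_avoids _ i n n.+1 h4; rewrite /= !order_iso3E fi pen0; lia.
have := @word_inj i.+1 n.+1; have := @word_inj i.+1 i; have := @word_inj i.+1 n.
(* With one letter between 1 and 0, avoiding 13-2 puts that letter below the last one; with 0 and
   the last letter it then forms 21-3. *)
have [e|ne2] := eqVneq i.+2 n.
  have := @word_avoids _ i.+1 n n.+1 h4; have := @word_avoids _ i i.+1 n.+1 h3.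
  rewrite /= !order_iso3E fi pen0; lia.
(* Farther left, 1 is followed by two larger letters, which give 1-23 or 1-32. *)
have := @word_inj i.+2 i.+1; have := @word_inj i.+2 i; have := @word_inj i.+2 n.
have := @word_avoids _ i i.+1 i.+2 h1; have := @word_avoids _ i i.+1 i.+2 h2.
rewrite /= !order_iso3E fi pen0; lia.
Qed.

(** An earlier maximum would form 3-12 with the penultimate 0 and the last letter. *)
Lemma last_eq_max_of_312 : a_bc 3 1 2 \in P -> f n.+1 = n.+1.
Proof.
move=> h; have [i hi fi] := word_surj (ltnSn n.+1).
have [e|ne] := eqVneq i n.+1; first by rewrite -{1}e fi.
have lt_i : i < n by apply: lt_penultimate => //; rewrite fi.
have := @word_inj i n.+1 hi; have := word_lt n.+1.
have := @word_avoids _ i n n.+1 h; rewrite /= !order_iso3E fi pen0; lia.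
Qed.

Lemma last_eq_max_of_31_2 : ab_c 3 1 2 \in P -> f n.+1 = n.+1.
Proof.
move=> h; have [i hi fi] := word_surj (ltnSn n.+1).
have [e|ne] := eqVneq i n.+1; first by rewrite -{1}e fi.
have lt_i : i < n by apply: lt_penultimate => //; rewrite fi.
(* From the maximum on, letters stay above the last one: an adjacent drop from above it to below it
   would complete 31-2. At position [n] this contradicts the letter 0. *)
have above d : i + d <= n -> f n.+1 < f (i + d).
  elim: d => [_|d IH hd].
    rewrite addn0 fi; have := word_lt n.+1; have := @word_inj i n.+1 hi; lia.
  have := @word_avoids _ (i + d) (i + d).+1 n.+1 h.
  have := @word_inj (i + d).+1 n.+1; have := IH.
  rewrite /= !order_iso3E addnS; lia.
have := above (n - i); rewrite subnKC; last exact: ltnW.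
by rewrite pen0; lia.
Qed.

End Word.

(** * The recurrence for the two groups of classes, and the Fibonacci count *)

Lemma inord_max n : inord n = ord_max :> 'I_n.+1.
Proof. by apply: val_inj; rewrite /= inordK. Qed.

Lemma inord_penultimate n : inord n = lift ord_max ord_max :> 'I_n.+2.
Proof. by apply: ord_inj; rewrite lift_max inordK. Qed.

(** The list bounds [P] from above, so that the appended letters create no occurrence; the
    memberships bound it from below, so that the ending is forced. The conjunction serves the one
    class of this group that lacks 2-13. *)
Lemma card_avoiders_second (P : seq gpattern) n :
  {subset P <= [:: a_bc 1 2 3; a_bc 2 1 3; a_bc 1 3 2; ab_c 1 2 3; ab_c 2 1 3; ab_c 1 3 2]} ->
  a_bc 1 2 3 \in P -> (a_bc 1 3 2 \in P) || (ab_c 1 3 2 \in P) ->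
  (a_bc 2 1 3 \in P) ||
    [&& a_bc 1 3 2 \in P, ab_c 1 3 2 \in P & ab_c 2 1 3 \in P] ->
  #|avoiders n.+2 P| = #|avoiders n.+1 P| + #|avoiders n P|.
Proof.
move=> PS h123 h132 h213; apply: (card_avoiders_rec (x := inord 1)).
- by rewrite inordK.
- move=> m s p /PS pS; apply: contains_lift0.
    by move: pS; rewrite !inE => /or4P[||| /or3P[]] /eqP->.
  by move: pS; rewrite !inE => /or4P[||| /or3P[]] /eqP->.
- by move=> s p /PS; apply: contains_lift_second.
move=> s sP; rewrite -inord_penultimate -inord_max -(inj_eq val_inj) => last0.
have pen0 := penultimate_eq0 sP last0 h123 h132.
split; apply: val_inj; rewrite /= ?inordK //.
case/orP: h213 => [h | /and3P[h1 h2 h3]]; first exact: last_eq1_of_213 h.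
exact: last_eq1_of_21_3 h1 h2 h3.
Qed.

Lemma card_avoiders_top (P : seq gpattern) n :
  {subset P <= [:: a_bc 1 2 3; a_bc 1 3 2; a_bc 3 1 2; ab_c 1 3 2; ab_c 3 1 2]} ->
  a_bc 1 2 3 \in P -> (a_bc 1 3 2 \in P) || (ab_c 1 3 2 \in P) ->
  (a_bc 3 1 2 \in P) || (ab_c 3 1 2 \in P) ->
  #|avoiders n.+2 P| = #|avoiders n.+1 P| + #|avoiders n P|.
Proof.
move=> PS h123 h132 h312; apply: (card_avoiders_rec (x := ord_max)) => //.
- move=> m s p /PS pS; apply: contains_lift0.
    by move: pS; rewrite !inE => /or4P[||| /orP[]] /eqP->.
  by move: pS; rewrite !inE => /or4P[||| /orP[]] /eqP->.
- by move=> s p /PS; apply: contains_lift_top.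
move=> s sP; rewrite -inord_penultimate -inord_max -(inj_eq val_inj) => last0.
have pen0 := penultimate_eq0 sP last0 h123 h132.
split; apply: val_inj; rewrite /= ?inordK //.
case/orP: h312 => h; first exact: last_eq_max_of_312 h.
exact: last_eq_max_of_31_2 h.
Qed.

Lemma card_avoiders_fib (P : seq gpattern) :
  (forall n, #|avoiders n.+2 P| = #|avoiders n.+1 P| + #|avoiders n P|) ->
  forall n, #|avoiders n P| = F n.
Proof.
move=> rec.
(* Words of length 0 and 1 have no room for a pattern; counting the empty one matches [F 0 = 1]. *)
have small n : n <= 1 -> #|avoiders n P| = 1.
  move=> n1; rewrite (_ : avoiders n P = setT); last first.
    apply/setP => s; rewrite !inE; apply/allP => p _; apply/containsP.
    move=> [i [j [k [/positions_lt ijk _]]]].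
    by have := ltn_ord k; lia.
  by rewrite cardsT card_Sn; case: n n1 => [|[]].
have both n : #|avoiders n P| = F n /\ #|avoiders n.+1 P| = F n.+1.
  by elim: n => [|n [IH1 IH2]]; [rewrite !small | rewrite rec IH1 IH2].
by move=> n; case: (both n).
Qed.

Theorem mainTheorem2 (P : seq gpattern)
  (hP : P \in
    [:: [:: a_bc 1 2 3; a_bc 2 1 3; a_bc 1 3 2; ab_c 2 1 3];
        [:: a_bc 1 2 3; a_bc 2 1 3; a_bc 1 3 2; ab_c 1 2 3];
        [:: a_bc 1 2 3; a_bc 2 1 3; ab_c 1 3 2; ab_c 2 1 3];
        [:: a_bc 1 2 3; a_bc 2 1 3; ab_c 1 3 2; a_bc 1 3 2];
        [:: a_bc 1 2 3; a_bc 2 1 3; ab_c 1 3 2; ab_c 1 2 3];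
        [:: a_bc 1 2 3; ab_c 2 1 3; ab_c 1 3 2; a_bc 1 3 2];
        [:: a_bc 1 2 3; ab_c 1 3 2; a_bc 3 1 2; a_bc 1 3 2];
        [:: a_bc 1 2 3; a_bc 1 3 2; ab_c 3 1 2; a_bc 3 1 2];
        [:: a_bc 1 2 3; ab_c 1 3 2; ab_c 3 1 2; a_bc 1 3 2];
        [:: a_bc 1 2 3; ab_c 1 3 2; ab_c 3 1 2; a_bc 3 1 2]])
  (n : nat) (hn : 1 <= n) :
  #|avoiders n P| = F n.
Proof.
apply: card_avoiders_fib => m; move: hP; rewrite !inE.
(* In the first six classes a penultimate 0 is followed by 1, in the other four by the maximum. *)
do 6![case/orP => [/eqP-> |]; first by apply: card_avoiders_second => //; apply/allP].
by move=> /or4P[] /eqP->; apply: card_avoiders_top => //; apply/allP.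
Qed.
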